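(* Let $\Omega=(0,\infty)$, $\lambda=0$ and $p>3$, and let $\varphi\in\mathcal{C}(\overline\Omega)$ be non-negative with $$\varphi(0)>2^{\frac{1-p}{p-3}} .$$ Then the problem $$\begin{cases}\partial_t u=\partial_x^2u-u\,\partial_xu+u^p & \text{in }\overline\Omega\times(0,\infty),\\ \partial_\nu u=0 & \text{on }\partial\Omega\times(0,\infty),\\ u(\cdot,0)=\varphi & \text{in }\overline\Omega\end{cases}$$ admits no global positive solution $u$ satisfying the growth condition: for all $a>0$ and all $t>0$, $$\lim_{|x|\to\infty}u(x,t)e^{-a|x|}=0\quad\text{and}\quad\lim_{|x|\to\infty}|\partial_xu(x,t)|e^{-a|x|}=0 .$$
   Context: $\partial_\nu$ is the outward normal derivative, so $\partial_\nu u(0,t)=-\partial_xu(0,t)$. A global solution is a function $u\in\mathcal{C}(\overline\Omega\times[0,\infty))\cap\mathcal{C}^{2,1}(\overline\Omega\times(0,\infty))$ satisfying the equations in the classical sense. Positive means $u>0$ in $\Omega\times(0,\infty)$. *)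

(* Defs.v *)
From Stdlib Require Import Reals.
From Coquelicot Require Import Coquelicot.
Open Scope R_scope.

Definition Omega (x : R) : Prop := 0 < x.
Definition Omega_bar (x : R) : Prop := 0 <= x.

(** Real power of a non-negative base. [Rpower 0 p] is [1] in the standard
    library, whereas the value [0 ^ p = 0] (for [p > 0]) is the one needed at
    boundary points, where a positive solution is only known to be [>= 0]. *)
Definition pow_nonneg (s p : R) : R :=
  if Rlt_dec 0 s then Rpower s p else 0.

Definition jointly_continuous_on (X T : R -> Prop) (v : R -> R -> R) : Prop :=
  continuous_on (fun z : R * R => X (fst z) /\ T (snd z))
                (fun z : R * R => v (fst z) (snd z)).

(** The space derivatives are taken within [Omega_bar], hence are one-sided
    at [x = 0]; values of [u] at negative arguments play no role. *)
Record C21 (u ut ux uxx : R -> R -> R) : Prop := {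
  C21_dt : forall x t, Omega_bar x -> 0 < t ->
    is_derive (fun s => u x s) t (ut x t);
  C21_dx : forall x t, Omega_bar x -> 0 < t ->
    D_in (fun y => u y t) (fun y => ux y t) Omega_bar x;
  C21_dxx : forall x t, Omega_bar x -> 0 < t ->
    D_in (fun y => ux y t) (fun y => uxx y t) Omega_bar x;
  C21_cont : jointly_continuous_on Omega_bar (Rlt 0) u;
  C21_cont_dt : jointly_continuous_on Omega_bar (Rlt 0) ut;
  C21_cont_dx : jointly_continuous_on Omega_bar (Rlt 0) ux;
  C21_cont_dxx : jointly_continuous_on Omega_bar (Rlt 0) uxx
}.

(** [ut], [ux], [uxx] are the partial derivatives of [u]; [C21] determines
    them on [Omega_bar * (0, oo)]. *)
Record global_solution (p : R) (phi : R -> R) (u ut ux uxx : R -> R -> R)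
  : Prop := {
  sol_cont : jointly_continuous_on Omega_bar (Rle 0) u;
  sol_C21 : C21 u ut ux uxx;
  sol_eq : forall x t, Omega_bar x -> 0 < t ->
    ut x t = uxx x t - u x t * ux x t + pow_nonneg (u x t) p;
  (* the outward normal derivative at the boundary point 0 is [- ux 0 t] *)
  sol_neumann : forall t, 0 < t -> - ux 0 t = 0;
  sol_init : forall x, Omega_bar x -> u x 0 = phi x
}.

Definition positive_in_Omega (u : R -> R -> R) : Prop :=
  forall x t, Omega x -> 0 < t -> 0 < u x t.

(** Within [Omega], [|x| -> oo] means [x -> +oo]. *)
Definition growth_condition (u ux : R -> R -> R) : Prop :=
  forall a t, 0 < a -> 0 < t ->
    is_lim (fun x => u x t * exp (- a * Rabs x)) p_infty 0 /\
    is_lim (fun x => Rabs (ux x t) * exp (- a * Rabs x)) p_infty 0.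

(* Main.v *)
Require Import Defs.
From Stdlib Require Import Reals.
From Coquelicot Require Import Coquelicot.
From Stdlib Require Import Lra Psatz Classical.
Open Scope R_scope.

(** Since [u > 0], it stays above any subsolution that starts below it and is nonpositive
    at the right end of a bounded interval. Without the source term, the Hopf-Cole
    substitution [w = - 2 W_x / W] turns subsolutions into solutions of the heat equation,
    the condition [w_x >= 0] at [x = 0] becoming [W_xx W <= W_x^2].

    Three subsolutions are used in succession. A self-similar one starts below an
    arbitrarily small bump at [x = 0]; the flux [u(0,t)^2 / 2] through the boundary makes
    its mass grow slowly, until it dominates a bump of height [4 k] and width [1 / k] for
    some [k]. From there an explicit [W] yields a plateau [u > k] on intervals of length
    growing linearly in time. Finally, on a long enough interval, the source term
    makes [(z(t) + x^2 / (8 q)) ^ (- q)], [q = 1 / (p - 1)], a subsolution that blows up in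
    finite time. *)

(** * Compactness and one-sided calculus *)

(** Compactness of [[0, L]] by a supremum: [good b] says that one radius serves on all of [[0, b]],
    and the radius at the supremum reaches beyond it unless it equals [L]. *)
Lemma tube_segment (P : R -> R -> Prop) (L m : R) :
  (forall x, 0 <= x <= L -> exists d, 0 < d /\
     forall y t, 0 <= y <= L -> Rabs (y - x) < d -> Rabs (t - m) < d -> P y t) ->
  exists d, 0 < d /\
     forall y t, 0 <= y <= L -> Rabs (t - m) < d -> P y t.
Proof.
  intros HP.
  destruct (Rlt_le_dec L 0) as [HL | HL].
  { exists 1; split; [lra |]. intros y t Hy; lra. }
  set (good := fun b => 0 <= b <= L /\ exists d, 0 < d /\
     forall y t, 0 <= y <= b -> Rabs (t - m) < d -> P y t).
  assert (good0 : good 0).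
  { split; [lra |]. destruct (HP 0) as [d [Hd H]]; [lra |].
    exists d; split; [exact Hd |]. intros y t Hy Ht. apply H; try lra.
    replace (y - 0) with 0 by lra. rewrite Rabs_R0; lra. }
  destruct (completeness good) as [b [Hub Hlub]].
  { exists L. intros z [Hz _]; lra. }
  { exists 0; exact good0. }
  assert (Hb : 0 <= b <= L).
  { split; [apply Hub; exact good0 | apply Hlub; intros z [Hz _]; lra]. }
  destruct (HP b Hb) as [d [Hd H]].
  assert (exists z, good z /\ b - d < z) as [z [[Hz [d' [Hd' H']]] Hzb]].
  { apply NNPP. intros Hn.
    assert (b <= b - d); [| lra].
    apply Hlub. intros z Hz. apply Rnot_lt_le. intros Hlt. apply Hn. exists z; auto. }
  assert (goodm : good (Rmin L (b + d / 2))).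
  { split.
    { split; [apply Rmin_glb; lra | apply Rmin_l]. }
    exists (Rmin d d'); split; [apply Rmin_glb_lt; lra |].
    intros y t Hy Ht.
    assert (Rmin d d' <= d) by apply Rmin_l.
    assert (Rmin d d' <= d') by apply Rmin_r.
    assert (Rmin L (b + d / 2) <= L) by apply Rmin_l.
    assert (Rmin L (b + d / 2) <= b + d / 2) by apply Rmin_r.
    destruct (Rle_lt_dec y z).
    - apply H'; lra.
    - apply H; try lra. apply Rabs_def1; lra. }
  assert (Rmin L (b + d / 2) <= b) by (apply Hub; exact goodm).
  assert (HbL : b = L).
  { unfold Rmin in H0. destruct (Rle_dec L (b + d / 2)); lra. }
  replace (Rmin L (b + d / 2)) with L in goodm.
  - destruct goodm as [_ [d0 H0']]. exists d0; exact H0'.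
  - rewrite Rmin_left; lra.
Qed.

(** Space derivatives at [0] exist only from within [Omega_bar]. With right derivatives, one
    second-order test covers a contact at [0] and a contact in the interior. *)
Definition right_derivative (f : R -> R) (x l : R) : Prop :=
  forall e, 0 < e -> exists d, 0 < d /\
    forall y, x < y < x + d -> Rabs ((f y - f x) / (y - x) - l) < e.

Lemma D_in_right_derivative (f d : R -> R) (x : R) :
  Omega_bar x -> D_in f d Omega_bar x -> right_derivative f x (d x).
Proof.
  intros Hx H e He. destruct (H e He) as [a [Ha Hy]].
  exists a; split; [exact Ha |]. intros y Hxy.
  apply (Hy y). unfold D_x, Omega_bar in *. simpl. unfold Rdist.
  repeat split; try lra. apply Rabs_def1; lra.
Qed.

Lemma D_in_is_derive (f d : R -> R) (x : R) :
  Omega x -> D_in f d Omega_bar x -> is_derive f x (d x).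
Proof.
  intros Hx H. apply is_derive_Reals. intros e He.
  destruct (H e He) as [a [Ha Hy]]. unfold Omega in Hx.
  assert (Hd : 0 < Rmin a x) by (apply Rmin_glb_lt; lra).
  exists (mkposreal _ Hd). simpl. intros h Hh Hlt.
  assert (Rmin a x <= a) by apply Rmin_l.
  assert (Rmin a x <= x) by apply Rmin_r.
  assert (Hlt' := Rabs_def2 _ _ Hlt).
  specialize (Hy (x + h)). unfold D_x, Omega_bar in Hy. simpl in Hy. unfold Rdist in Hy.
  replace (x + h - x) with h in Hy by ring.
  apply Hy. repeat split; lra.
Qed.

Lemma is_derive_right_derivative (f : R -> R) (x l : R) :
  is_derive f x l -> right_derivative f x l.
Proof.
  intros H%is_derive_Reals e He. destruct (H e He) as [d Hd].
  exists d; split; [apply cond_pos |]. intros y Hy.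
  replace (f y) with (f (x + (y - x))) by (f_equal; ring).
  apply Hd; [lra |]. apply Rabs_def1; lra.
Qed.

Lemma right_derivative_minus (f g : R -> R) (x l k : R) :
  right_derivative f x l -> right_derivative g x k ->
  right_derivative (fun y => f y - g y) x (l - k).
Proof.
  intros Hf Hg e He.
  destruct (Hf (e / 2)) as [d1 [Hd1 H1]]; [lra |].
  destruct (Hg (e / 2)) as [d2 [Hd2 H2]]; [lra |].
  exists (Rmin d1 d2); split; [apply Rmin_glb_lt; lra |].
  intros y Hy.
  assert (Rmin d1 d2 <= d1) by apply Rmin_l.
  assert (Rmin d1 d2 <= d2) by apply Rmin_r.
  specialize (H1 y). specialize (H2 y).
  replace ((f y - g y - (f x - g x)) / (y - x) - (l - k))
    with (((f y - f x) / (y - x) - l) - ((g y - g x) / (y - x) - k)) by (field; lra).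
  assert (A := Rabs_def2 _ _ (H1 ltac:(lra))).
  assert (B := Rabs_def2 _ _ (H2 ltac:(lra))).
  apply Rabs_def1; lra.
Qed.

Lemma right_derivative_nonneg_at_min (f : R -> R) (x l : R) :
  right_derivative f x l ->
  (exists d, 0 < d /\ forall y, x < y < x + d -> f x <= f y) -> 0 <= l.
Proof.
  intros H [d [Hd Hmin]]. apply Rnot_lt_le. intros Hl.
  destruct (H (- l)) as [d' [Hd' H']]; [lra |].
  assert (Hm : 0 < Rmin d d') by (apply Rmin_glb_lt; lra).
  assert (Rmin d d' <= d) by apply Rmin_l.
  assert (Rmin d d' <= d') by apply Rmin_r.
  set (y := x + Rmin d d' / 2).
  assert (Hq := Rabs_def2 _ _ (H' y ltac:(unfold y; lra))).
  assert (Hy := Hmin y ltac:(unfold y; lra)).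
  assert (0 <= (f y - f x) / (y - x)); [| lra].
  apply Rle_div_r; unfold y in *; lra.
Qed.

(** If [l < 0], then [f1 < 0] just to the right of [x], so [f] decreases strictly there; being
    right-continuous at [x], it would fall below [f x]. *)
Lemma right_second_derivative_nonneg_at_min (f f1 : R -> R) (x l : R) :
  right_derivative f x 0 ->
  (forall y, x < y -> is_derive f y (f1 y)) ->
  f1 x = 0 -> right_derivative f1 x l ->
  (exists d, 0 < d /\ forall y, x < y < x + d -> f x <= f y) -> 0 <= l.
Proof.
  intros H0 H1 Hx H2 [d [Hd Hmin]]. apply Rnot_lt_le. intros Hl.
  destruct (H2 (- l)) as [d' [Hd' H']]; [lra |].
  assert (Hneg : forall y, x < y < x + d' -> f1 y < 0).
  { intros y Hy. assert (Hq := Rabs_def2 _ _ (H' y Hy)). rewrite Hx in Hq.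
    assert (Hq' : (f1 y - 0) / (y - x) < 0) by lra.
    apply Rlt_div_l in Hq'; lra. }
  assert (Hdec : forall y z, x < y < z -> z < x + d' -> f z < f y).
  { intros y z Hyz Hz.
    destruct (MVT_gen f y z f1) as [c [Hc E]].
    - intros c Hc. rewrite Rmin_left in Hc by lra. apply H1; lra.
    - intros c Hc. rewrite Rmin_left in Hc by lra.
      apply derivable_continuous_pt. exists (f1 c). apply is_derive_Reals, H1; lra.
    - rewrite Rmin_left, Rmax_right in Hc by lra.
      assert (f1 c < 0) by (apply Hneg; lra). nra. }
  assert (Hm : 0 < Rmin d d') by (apply Rmin_glb_lt; lra).
  assert (Rmin d d' <= d) by apply Rmin_l.
  assert (Rmin d d' <= d') by apply Rmin_r.
  set (z := x + Rmin d d' / 2). set (v := x + Rmin d d' / 4).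
  assert (Hvz := Hdec v z ltac:(unfold v, z; lra) ltac:(unfold z; lra)).
  assert (Hxz := Hmin z ltac:(unfold z; lra)).
  (* The mean value theorem was applied strictly to the right of [x]. Right continuity closes the
     gap: for [y] close to [x], [f y - f x < y - x < g] gives [f y < f v], against the decrease. *)
  destruct (H0 1) as [d3 [Hd3 Hr3]]; [lra |].
  set (g := f v - f x).
  assert (Hg : 0 < g) by (unfold g; lra).
  set (y := x + Rmin (Rmin d3 (Rmin d d' / 4)) g / 2).
  assert (Hr : 0 < Rmin (Rmin d3 (Rmin d d' / 4)) g) by (repeat apply Rmin_glb_lt; lra).
  assert (Rmin (Rmin d3 (Rmin d d' / 4)) g <= g) by apply Rmin_r.
  assert (Rmin (Rmin d3 (Rmin d d' / 4)) g <= Rmin d3 (Rmin d d' / 4)) by apply Rmin_l.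
  assert (Rmin d3 (Rmin d d' / 4) <= d3) by apply Rmin_l.
  assert (Rmin d3 (Rmin d d' / 4) <= Rmin d d' / 4) by apply Rmin_r.
  assert (Hyv := Hdec y v ltac:(unfold y, v; lra) ltac:(unfold v; lra)).
  assert (Hq := Rabs_def2 _ _ (Hr3 y ltac:(unfold y; lra))).
  assert (Hq' : (f y - f x) / (y - x) < 1) by lra.
  apply Rlt_div_l in Hq'; [| unfold y; lra].
  unfold g in *; unfold y in *; lra.
Qed.

Lemma is_derive_pos_left (f : R -> R) (x l : R) :
  is_derive f x l -> 0 < l ->
  exists d, 0 < d /\ forall y, x - d < y < x -> f y < f x.
Proof.
  intros H%is_derive_Reals Hl. destruct (H l Hl) as [d Hd].
  exists d; split; [apply cond_pos |]. intros y Hy.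
  assert (Hq := Rabs_def2 _ _ (Hd (y - x) ltac:(lra) ltac:(apply Rabs_def1; lra))).
  replace (x + (y - x)) with y in Hq by ring.
  assert (Hq' : 0 < (f y - f x) / (y - x)) by lra.
  assert (Hm : 0 < (f y - f x) / (y - x) * (x - y)) by (apply Rmult_lt_0_compat; lra).
  replace ((f y - f x) / (y - x) * (x - y)) with (f x - f y) in Hm by (field; lra).
  lra.
Qed.

Lemma jointly_continuous_on_eps (X T : R -> Prop) (v : R -> R -> R) (x t e : R) :
  jointly_continuous_on X T v -> X x -> T t -> 0 < e ->
  exists d, 0 < d /\ forall y s, X y -> T s -> Rabs (y - x) < d -> Rabs (s - t) < d ->
    Rabs (v y s - v x t) < e.
Proof.
  intros H Hx Ht He.
  specialize (H (x, t) (conj Hx Ht)).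
  destruct (proj1 (filterlim_locally _ _) H (mkposreal e He)) as [d Hd].
  exists d; split; [apply cond_pos |].
  intros y s Hy Hs Hyx Hst.
  exact (Hd (y, s) (conj Hyx Hst) (conj Hy Hs)).
Qed.

Lemma continuous_pair_eps (w : R -> R -> R) (x t e : R) :
  continuous (fun z : R * R => w (fst z) (snd z)) (x, t) -> 0 < e ->
  exists d, 0 < d /\ forall y s, Rabs (y - x) < d -> Rabs (s - t) < d ->
    Rabs (w y s - w x t) < e.
Proof.
  intros H He.
  destruct (proj1 (filterlim_locally _ _) H (mkposreal e He)) as [d Hd].
  exists d; split; [apply cond_pos |].
  intros y s Hyx Hst. exact (Hd (y, s) (conj Hyx Hst)).
Qed.

(** * Comparison with subsolutions, first in general and then for Hopf-Cole potentials *)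

(** At a first contact, [u] and [w] share value and slope, while [u - w] has a nonnegative second
    space derivative and a nonpositive time derivative; this contradicts the strict inequality for
    [w]. Contact forces [w > 0], so that inequality is demanded only there. *)
Lemma comparison (p : R) (phi : R -> R) (u ut ux uxx w wt wx wxx : R -> R -> R)
  (L t0 t1 : R) :
  global_solution p phi u ut ux uxx -> positive_in_Omega u ->
  0 < L -> 0 < t0 ->
  (forall x t, 0 <= x <= L -> t0 <= t <= t1 ->
     continuous (fun z : R * R => w (fst z) (snd z)) (x, t)) ->
  (forall x, 0 <= x <= L -> w x t0 < u x t0) ->
  (forall t, t0 <= t <= t1 -> w L t < u L t) ->
  (forall t, t0 <= t <= t1 -> 0 < w 0 t /\ 0 <= wx 0 t) ->
  (forall x t, 0 <= x -> t0 <= t <= t1 -> is_derive (fun y => w y t) x (wx x t)) ->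
  (forall x t, 0 <= x -> t0 <= t <= t1 -> is_derive (fun y => wx y t) x (wxx x t)) ->
  (forall x t, 0 <= x -> t0 <= t <= t1 -> is_derive (fun s => w x s) t (wt x t)) ->
  (forall x t, 0 <= x -> t0 <= t <= t1 -> 0 < w x t ->
     wt x t < wxx x t - w x t * wx x t + Rpower (w x t) p) ->
  forall x t, 0 <= x <= L -> t0 <= t <= t1 -> w x t < u x t.
Proof.
  intros Hu Hpos HL Ht0 Hcont Hinit Hlat Hzero Hwx Hwxx Hwt Hsub x0 t' Hx0 Ht'.
  destruct Hu as [_ [Udt Udx Udxx Ucont _ _ _] Ueq Uneu _].
  (* The supremum [m] of the times up to which the strict order holds is shown to be attained, and
     then to equal [t1]. *)
  set (good := fun T => t0 <= T <= t1 /\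
    forall t x, t0 <= t <= T -> 0 <= x <= L -> w x t < u x t).
  assert (good0 : good t0).
  { split; [lra |]. intros t x Ht Hx. replace t with t0 by lra. auto. }
  destruct (completeness good) as [m [Hub Hlub]].
  { exists t1. intros z [Hz _]; lra. }
  { exists t0; exact good0. }
  assert (Hm : t0 <= m <= t1).
  { split; [apply Hub; exact good0 | apply Hlub; intros z [Hz _]; lra]. }
  assert (before : forall t x, t0 <= t < m -> 0 <= x <= L -> w x t < u x t).
  { intros t x Ht Hx. apply NNPP. intros Hn.
    assert (m <= t); [| lra].
    apply Hlub. intros z [Hz1 Hz2]. apply Rnot_lt_le. intros Hlt.
    apply Hn, Hz2; lra. }
  assert (near : forall x e, 0 <= x <= L -> 0 < e -> exists d, 0 < d /\
    forall y t, 0 <= y <= L -> Rabs (y - x) < d -> Rabs (t - m) < d ->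
      0 < t -> Rabs ((u y t - w y t) - (u x m - w x m)) < e).
  { intros x e Hx He.
    destruct (jointly_continuous_on_eps _ _ _ x m (e / 2) Ucont) as [d1 [Hd1 H1]];
      [unfold Omega_bar; lra | lra | lra |].
    destruct (continuous_pair_eps w x m (e / 2)) as [d2 [Hd2 H2]]; [auto | lra |].
    exists (Rmin d1 d2); split; [apply Rmin_glb_lt; lra |].
    intros y t Hy Hyx Htm Htp.
    assert (Rmin d1 d2 <= d1) by apply Rmin_l.
    assert (Rmin d1 d2 <= d2) by apply Rmin_r.
    assert (A := Rabs_def2 _ _ (H1 y t ltac:(unfold Omega_bar; lra) Htp ltac:(lra) ltac:(lra))).
    assert (B := Rabs_def2 _ _ (H2 y t ltac:(lra) ltac:(lra))).
    apply Rabs_def1; lra. }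
  assert (weak : forall x, 0 <= x <= L -> w x m <= u x m).
  { intros x Hx. apply Rnot_lt_le. intros Hlt.
    destruct (Req_dec m t0) as [E | E]; [subst m; specialize (Hinit x Hx); lra |].
    destruct (near x (w x m - u x m) Hx) as [d [Hd H]]; [lra |].
    set (t := Rmax t0 (m - d / 2)).
    assert (t0 <= t) by apply Rmax_l.
    assert (m - d / 2 <= t) by apply Rmax_r.
    assert (t < m) by (apply Rmax_lub_lt; lra).
    assert (A := Rabs_def2 _ _ (H x t Hx ltac:(rewrite Rminus_diag, Rabs_R0; lra)
      ltac:(apply Rabs_def1; lra) ltac:(lra))).
    assert (B := before t x ltac:(lra) Hx). lra. }
  assert (strict : forall x, 0 <= x <= L -> w x m < u x m).
  { intros x Hx. destruct (weak x Hx) as [Hlt | E]; [exact Hlt | exfalso].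
    destruct (Req_dec m t0) as [E' | E']; [subst m; specialize (Hinit x Hx); lra |].
    assert (HxL : x < L).
    { destruct (Req_dec x L) as [E'' | E'']; [| lra].
      subst x. specialize (Hlat m Hm). lra. }
    assert (Hw : 0 < w x m).
    { destruct (Req_dec x 0) as [Ex | Ex]; [subst x; apply Hzero; exact Hm |].
      rewrite E. apply Hpos; unfold Omega; lra. }
    assert (Hmin : exists d, 0 < d /\ forall y, x < y < x + d ->
      u x m - w x m <= u y m - w y m).
    { exists (L - x); split; [lra |]. intros y Hy.
      assert (w y m <= u y m) by (apply weak; lra). lra. }
    assert (Dx : right_derivative (fun y => u y m - w y m) x (ux x m - wx x m)).
    { apply right_derivative_minus.
      - apply (D_in_right_derivative _ (fun y => ux y m)).
        + unfold Omega_bar; lra.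
        + apply Udx; unfold Omega_bar; lra.
      - apply is_derive_right_derivative, Hwx; [lra | exact Hm]. }
    assert (Dxx : right_derivative (fun y => ux y m - wx y m) x (uxx x m - wxx x m)).
    { apply right_derivative_minus.
      - apply (D_in_right_derivative _ (fun y => uxx y m)).
        + unfold Omega_bar; lra.
        + apply Udxx; unfold Omega_bar; lra.
      - apply is_derive_right_derivative, Hwxx; [lra | exact Hm]. }
    assert (Dy : forall y, 0 < y ->
      is_derive (fun y => u y m - w y m) y (ux y m - wx y m)).
    { intros y Hy. apply (is_derive_minus (fun z => u z m) (fun z => w z m)).
      - apply (D_in_is_derive _ (fun y => ux y m)).
        + unfold Omega; lra.
        + apply Udx; unfold Omega_bar; lra.
      - apply Hwx; [lra | exact Hm]. }
    (* At [x = 0] the minimum gives [ux - wx >= 0], and the Neumann condition with [wx >= 0] gives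
       the converse. In the interior, a positive slope would put smaller values on the left. *)
    assert (Ex : ux x m = wx x m).
    { assert (H0 := right_derivative_nonneg_at_min _ _ _ Dx Hmin).
      destruct (Req_dec x 0) as [Ex | Ex].
      - subst x. assert (A := Uneu m ltac:(lra)). destruct (Hzero m Hm) as [_ B]. lra.
      - assert (Hd := Dy x ltac:(lra)).
        destruct (Rle_lt_or_eq_dec _ _ H0) as [Hlt |]; [exfalso | lra].
        destruct (is_derive_pos_left _ _ _ Hd Hlt) as [d [Hd0 Hd']].
        assert (Hy : exists y, x - d < y < x /\ 0 <= y).
        { exists (Rmax 0 (x - d / 2)). unfold Rmax. destruct (Rle_dec _ _); lra. }
        destruct Hy as [y [Hy Hy0]].
        assert (A := Hd' y Hy). assert (B := weak y ltac:(lra)). lra. }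
    assert (Exx : 0 <= uxx x m - wxx x m).
    { apply (right_second_derivative_nonneg_at_min
        (fun y => u y m - w y m) (fun y => ux y m - wx y m) x).
      - rewrite <- (Rminus_diag (wx x m)). rewrite <- Ex at 1. exact Dx.
      - intros y Hy. apply Dy; lra.
      - lra.
      - exact Dxx.
      - exact Hmin. }
    assert (Et : ut x m - wt x m <= 0).
    { assert (Hd : is_derive (fun s => u x s - w x s) m (ut x m - wt x m)).
      { apply (is_derive_minus (fun s => u x s) (fun s => w x s)); [apply Udt; unfold Omega_bar; lra | apply Hwt; lra]. }
      apply Rnot_lt_le. intros Hlt.
      destruct (is_derive_pos_left _ _ _ Hd Hlt) as [d [Hd0 Hd']].
      assert (Hs : exists s, m - d < s < m /\ t0 <= s).
      { exists (Rmax t0 (m - d / 2)). unfold Rmax. destruct (Rle_dec _ _); lra. }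
      destruct Hs as [s [Hs Hs0]].
      assert (A := Hd' s Hs). simpl in A. assert (B := before s x ltac:(lra) Hx). lra. }
    assert (S := Hsub x m ltac:(lra) Hm Hw).
    assert (Q := Ueq x m ltac:(unfold Omega_bar; lra) ltac:(lra)).
    (* As [w x m > 0], [pow_nonneg] is the genuine power, and the convection and source terms of [u]
       and [w] cancel. *)
    rewrite <- E, Ex in Q. unfold pow_nonneg in Q.
    destruct (Rlt_dec 0 (w x m)); [| lra]. lra. }
  assert (goodm : good m).
  { split; [exact Hm |]. intros t x Ht Hx.
    destruct (Req_dec t m) as [-> | ]; [auto | apply before; lra]. }
  destruct (Req_dec m t1) as [E | E].
  { apply goodm; lra. }
  exfalso.
  (* Strict order on the compact slice at time [m] persists a little longer, against the choice of
     [m]. *)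
  destruct (tube_segment (fun y t => 0 < t -> w y t < u y t) L m) as [d [Hd H]].
  { intros x Hx. assert (A := strict x Hx).
    destruct (near x (u x m - w x m) Hx) as [d [Hd H]]; [lra |].
    exists d; split; [exact Hd |]. intros y t Hy Hyx Htm Htp.
    assert (B := Rabs_def2 _ _ (H y t Hy Hyx Htm Htp)). lra. }
  assert (Hmp : 0 < Rmin d (t1 - m)) by (apply Rmin_glb_lt; lra).
  assert (Rmin d (t1 - m) <= d) by apply Rmin_l.
  assert (Rmin d (t1 - m) <= t1 - m) by apply Rmin_r.
  assert (m + Rmin d (t1 - m) / 2 <= m); [| lra].
  apply Hub. split; [lra |].
  intros t x Ht Hx. destruct (Rle_lt_dec t m).
  - apply goodm; lra.
  - apply H; [exact Hx | apply Rabs_def1; lra | lra].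
Qed.

(* [w = - 2 W_x / W] satisfies
   [w_t - w_xx + w w_x = - 2 ((P_t - T) W - P (W_t - Q)) / W^2]. *)
Lemma hopf_cole_comparison (p : R) (phi : R -> R)
  (u ut ux uxx W P Q T Wt Pt : R -> R -> R) (L t0 t1 : R) :
  global_solution p phi u ut ux uxx -> positive_in_Omega u ->
  0 < L -> 0 < t0 ->
  (forall x t, 0 <= x -> t0 <= t <= t1 -> 0 < W x t) ->
  (forall x t, 0 <= x -> t0 <= t <= t1 ->
     continuous (fun z : R * R => W (fst z) (snd z)) (x, t)) ->
  (forall x t, 0 <= x -> t0 <= t <= t1 ->
     continuous (fun z : R * R => P (fst z) (snd z)) (x, t)) ->
  (forall x t, t0 <= t <= t1 -> is_derive (fun y => W y t) x (P x t)) ->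
  (forall x t, t0 <= t <= t1 -> is_derive (fun y => P y t) x (Q x t)) ->
  (forall x t, t0 <= t <= t1 -> is_derive (fun y => Q y t) x (T x t)) ->
  (forall x t, t0 <= t <= t1 -> is_derive (fun s => W x s) t (Wt x t)) ->
  (forall x t, t0 <= t <= t1 -> is_derive (fun s => P x s) t (Pt x t)) ->
  (forall x, 0 <= x <= L -> - 2 * P x t0 / W x t0 < u x t0) ->
  (forall t, t0 <= t <= t1 -> 0 <= P L t) ->
  (forall t, t0 <= t <= t1 -> P 0 t < 0 /\ Q 0 t * W 0 t <= P 0 t * P 0 t) ->
  (forall x t, 0 <= x -> t0 <= t <= t1 -> P x t < 0 ->
     0 <= (Pt x t - T x t) * W x t - P x t * (Wt x t - Q x t)) ->
  forall x t, 0 <= x <= L -> t0 <= t <= t1 -> - 2 * P x t / W x t < u x t.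
Proof.
  intros Hu Hpos HL Ht0 HW CW CP DW DP DQ DtW DtP Hinit Hlat Hzero Hsub.
  apply (comparison p phi u ut ux uxx
    (fun x t => - 2 * P x t / W x t)
    (fun x t => - 2 * (Pt x t * W x t - P x t * Wt x t) / (W x t * W x t))
    (fun x t => - 2 * (Q x t * W x t - P x t * P x t) / (W x t * W x t))
    (fun x t => - 2 * (T x t / W x t - 3 * P x t * Q x t / (W x t * W x t)
       + 2 * (P x t * P x t * P x t) / (W x t * W x t * W x t)))
    L t0 t1); try assumption.
  - intros x t Hx Ht. specialize (HW x t ltac:(lra) Ht).
    apply (continuous_mult (fun z : R * R => - 2 * P (fst z) (snd z))
             (fun z : R * R => / W (fst z) (snd z))).
    + apply (continuous_scal_r (-2) (fun z : R * R => P (fst z) (snd z))).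
      apply CP; [lra | exact Ht].
    + apply (continuous_comp (fun z : R * R => W (fst z) (snd z)) Rinv).
      * apply CW; [lra | exact Ht].
      * apply continuous_Rinv. simpl. lra.
  - intros t Ht. assert (0 < u L t) by (apply Hpos; unfold Omega; lra).
    specialize (HW L t ltac:(lra) Ht). specialize (Hlat t Ht).
    assert (- 2 * P L t / W L t <= 0); [| lra].
    apply Rle_div_l; lra.
  - intros t Ht. specialize (HW 0 t ltac:(lra) Ht). destruct (Hzero t Ht) as [A B].
    split.
    + apply Rdiv_lt_0_compat; lra.
    + apply Rle_div_r; nra.
  - intros x t Hx Ht. specialize (HW x t Hx Ht).
    evar_last.
    { apply (is_derive_div (fun y => -2 * P y t) (fun y => W y t)).
      - apply (is_derive_scal (fun y => P y t)). apply DP; exact Ht.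
      - apply DW; exact Ht.
      - lra. }
    simpl. field; lra.
  - intros x t Hx Ht. specialize (HW x t Hx Ht).
    evar_last.
    { apply (is_derive_div (fun y => -2 * (Q y t * W y t - P y t * P y t))
        (fun y => W y t * W y t)).
      - apply (is_derive_scal (fun y => Q y t * W y t - P y t * P y t)).
        apply (is_derive_minus (fun y => Q y t * W y t) (fun y => P y t * P y t)).
        + apply (is_derive_mult (fun y => Q y t) (fun y => W y t));
            [apply DQ | apply DW | intros; apply Rmult_comm]; exact Ht.
        + apply (is_derive_mult (fun y => P y t) (fun y => P y t));
            [apply DP | apply DP | intros; apply Rmult_comm]; exact Ht.
      - apply (is_derive_mult (fun y => W y t) (fun y => W y t));
            [apply DW | apply DW | intros; apply Rmult_comm]; exact Ht.
      - nra. }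
    unfold minus, plus, opp, mult, scal; simpl. unfold mult; simpl. field; lra.
  - intros x t Hx Ht. specialize (HW x t Hx Ht).
    evar_last.
    { apply (is_derive_div (fun s => -2 * P x s) (fun s => W x s)).
      - apply (is_derive_scal (fun s => P x s)). apply DtP; exact Ht.
      - apply DtW; exact Ht.
      - lra. }
    simpl. field; lra.
  - intros x t Hx Ht Hw. specialize (HW x t Hx Ht).
    assert (HP : P x t < 0).
    { apply Rnot_le_lt. intros H.
      assert (- 2 * P x t / W x t <= 0); [apply Rle_div_l; lra | lra]. }
    assert (A := Hsub x t Hx Ht HP).
    (* Without the source the residual of [w] is only nonpositive; the positive power makes the
       inequality strict. *)
    assert (B : 0 < Rpower (- 2 * P x t / W x t) p) by apply exp_pos.
    assert (C : 0 <= ((Pt x t - T x t) * W x t - P x t * (Wt x t - Q x t))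
      / (W x t * W x t)) by (apply Rle_div_r; nra).
    match goal with |- ?l < ?r + _ => assert (l - r = - 2 *
      (((Pt x t - T x t) * W x t - P x t * (Wt x t - Q x t)) / (W x t * W x t)))
      by (field; lra) end.
    lra.
Qed.

(** * Spreading of a plateau, with the continuity and exponential estimates behind it *)

Lemma continuity_2d_pt_continuous (f : R -> R -> R) (x t : R) :
  continuity_2d_pt f x t -> continuous (fun z : R * R => f (fst z) (snd z)) (x, t).
Proof. intros H. apply continuity_2d_pt_filterlim, H. Qed.

Lemma continuity_2d_pt_comp (f g : R -> R -> R) (h : R -> R) (x t : R) :
  (forall y s, f y s = h (g y s)) ->
  ex_derive h (g x t) -> continuity_2d_pt g x t -> continuity_2d_pt f x t.
Proof.
  intros E Hh Hg. apply (continuity_2d_pt_ext (fun y s => h (g y s))).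
  { intros; symmetry; apply E. }
  apply continuity_1d_2d_pt_comp; [| exact Hg].
  destruct Hh as [l Hl]. apply derivable_continuous_pt. exists l.
  apply is_derive_Reals, Hl.
Qed.

Lemma exp_nondecreasing (x y : R) : x <= y -> exp x <= exp y.
Proof.
  intros [H | ->]; [apply Rlt_le, exp_increasing, H | lra].
Qed.

Lemma exp_ge_1p (x : R) : 1 + x <= exp x.
Proof.
  destruct (Req_dec x 0) as [-> |].
  - rewrite exp_0; lra.
  - apply Rlt_le, exp_ineq1; assumption.
Qed.

(** From [exp x = exp 1 * exp (x - 1) >= exp 1 * x] and [exp 1 > 2]. This keeps the potential of
    [plateau_spreads] positive. *)
Lemma two_mul_lt_exp (x : R) : 2 * x < exp x.
Proof.
  assert (A := exp_ge_1p (x - 1)). assert (B := exp_ineq1 1 ltac:(lra)).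
  assert (C := exp_pos x).
  replace (exp x) with (exp 1 * exp (x - 1)) in * by (rewrite <- exp_plus; f_equal; lra).
  destruct (Rle_lt_dec x 0); nra.
Qed.

Ltac continuity_2d :=
  unfold Rminus; repeat first
    [ assumption
    | apply continuity_2d_pt_plus
    | apply continuity_2d_pt_mult
    | apply continuity_2d_pt_opp
    | apply continuity_2d_pt_const
    | apply continuity_2d_pt_id1
    | apply continuity_2d_pt_id2 ].

(* [auto_derive] leaves equations typed in [R_NormedModule], which [ring] and [field] reject. *)
Ltac real_equation := match goal with |- ?a = ?b => change (@eq R a b) end.

Ltac by_auto_derive :=
  auto_derive;
  [exact I | unfold Rminus; real_equation; ring].

(* The potential [W = 1 + 2 (2 tau - y) exp (tau - y)], with [y = k x] and
   [tau = k^2 (t - t0)], solves the heat equation; [- 2 W_x / W] is positive exactly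
   for [y < 2 tau + 1] and tends to the plateau [2 k]. *)
Lemma plateau_spreads (p : R) (phi : R -> R) (u ut ux uxx : R -> R -> R) (t0 k : R) :
  global_solution p phi u ut ux uxx -> positive_in_Omega u ->
  0 < t0 -> 0 < k ->
  (forall x, 0 <= x <= 1 / k -> 4 * k < u x t0) ->
  forall x t, 1 / 2 <= k * k * (t - t0) -> 0 <= x -> k * x <= k * k * (t - t0) ->
  k < u x t.
Proof.
  intros Hu Hpos Ht0 Hk Hinit x1 t1 Ht1 Hx1 Hxt1.
  set (z := fun x t => 2 * (k * k * (t - t0)) - k * x).
  set (e := fun x t => exp (k * k * (t - t0) - k * x)).
  assert (Htt : t0 < t1) by nra.
  assert (Htau : forall t, t0 <= t <= t1 -> 0 <= k * k * (t - t0) <= k * k * (t1 - t0)).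
  { intros t Ht. assert (0 < k * k) by nra. nra. }
  (* At this right end [z <= -1] up to time [t1], so the subsolution is nonpositive there. *)
  set (L := (2 * (k * k * (t1 - t0)) + 1) / k).
  assert (HkL : k * L = 2 * (k * k * (t1 - t0)) + 1) by (unfold L; field; lra).
  assert (HL : 0 < L) by (apply Rdiv_lt_0_compat; nra).
  assert (Hx1L : x1 <= L).
  { unfold L. apply Rle_div_r; nra. }
  (* Scaled time is nonnegative, so [e <= exp z]; for [z < 0] this gives
     [2 |z| e <= 2 |z| exp (- |z|) < 1]. *)
  assert (HWpos : forall x t, t0 <= t <= t1 -> 0 < 1 + 2 * z x t * e x t).
  { intros x t Ht.
    assert (He : 0 < e x t) by apply exp_pos.
    assert (Hle : e x t <= exp (z x t)).
    { unfold e, z. destruct (Rle_lt_or_eq_dec _ _ (proj1 (Htau t Ht))).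
      - apply Rlt_le, exp_increasing; lra.
      - right; f_equal; lra. }
    assert (A := two_mul_lt_exp (- z x t)).
    assert (B : exp (z x t) * exp (- z x t) = 1)
      by (rewrite <- exp_plus, Rplus_opp_r; apply exp_0).
    assert (0 < exp (z x t)) by apply exp_pos.
    destruct (Rle_lt_dec 0 (z x t)); [nra |].
    assert (exp (z x t) * (2 * - z x t) < 1) by nra. nra. }
  assert (Cz : forall x t, continuity_2d_pt z x t) by (intros; unfold z; continuity_2d).
  assert (Ce : forall x t, continuity_2d_pt e x t).
  { intros x t.
    apply (continuity_2d_pt_comp _ (fun x t => k * k * (t - t0) - k * x) exp).
    - reflexivity.
    - auto_derive; exact I.
    - continuity_2d. }
  assert (Hmain : - 2 * (- 2 * k * (1 + z x1 t1) * e x1 t1)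
      / (1 + 2 * z x1 t1 * e x1 t1) < u x1 t1).
  { refine (hopf_cole_comparison p phi u ut ux uxx
      (fun x t => 1 + 2 * z x t * e x t)
      (fun x t => - 2 * k * (1 + z x t) * e x t)
      (fun x t => 2 * k * k * (2 + z x t) * e x t)
      (fun x t => - 2 * k * k * k * (3 + z x t) * e x t)
      (fun x t => 2 * k * k * (2 + z x t) * e x t)
      (fun x t => - 2 * k * k * k * (3 + z x t) * e x t)
      L t0 t1 Hu Hpos HL Ht0 _ _ _ _ _ _ _ _ _ _ _ _ x1 t1 _ _); try lra.
    - intros x t _ Ht; apply HWpos; exact Ht.
    - intros x t _ Ht.
      apply (continuity_2d_pt_continuous (fun x t => 1 + 2 * z x t * e x t)).
      specialize (Cz x t). specialize (Ce x t). continuity_2d.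
    - intros x t _ Ht.
      apply (continuity_2d_pt_continuous (fun x t => - 2 * k * (1 + z x t) * e x t)).
      specialize (Cz x t). specialize (Ce x t). continuity_2d.
    - intros x t Ht. unfold z, e. by_auto_derive.
    - intros x t Ht. unfold z, e. by_auto_derive.
    - intros x t Ht. unfold z, e. by_auto_derive.
    - intros x t Ht. unfold z, e. by_auto_derive.
    - intros x t Ht. unfold z, e. by_auto_derive.
    (* With [y = k x] the initial profile is [4 k (1 - y) exp (- y) / (1 - 2 y exp (- y))]. It is at
       most [4 k] because [(1 + y) exp (- y) <= 1], and negative for [y > 1]. *)
    - intros x Hx.
      assert (HW := HWpos x t0 ltac:(lra)).
      assert (Ez : z x t0 = - (k * x)) by (unfold z; ring).
      assert (Ee : e x t0 = exp (- (k * x))) by (unfold e; f_equal; ring).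
      rewrite Ez, Ee in *.
      assert (He : 0 < exp (- (k * x))) by apply exp_pos.
      destruct (Rle_lt_dec (k * x) 1) as [H1 | H1].
      + apply Rle_lt_trans with (4 * k).
        * apply Rle_div_l; [exact HW |].
          assert (A := exp_ge_1p (k * x)).
          assert (B : exp (k * x) * exp (- (k * x)) = 1)
            by (rewrite <- exp_plus, Rplus_opp_r; apply exp_0).
          assert ((1 + k * x) * exp (- (k * x)) <= 1) by nra. nra.
        * apply Hinit. split; [lra |]. apply Rle_div_r; lra.
      + apply Rle_lt_trans with 0.
        * apply Rle_div_l; [exact HW |].
          assert (0 <= (k * x - 1) * exp (- (k * x)) * k)
            by (repeat apply Rmult_le_pos; lra). nra.
        * apply Hpos; unfold Omega; [| lra]. nra.
    - intros t Ht. assert (He : 0 < e L t) by apply exp_pos.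
      assert (z L t <= -1). { unfold z. specialize (Htau t Ht). lra. }
      assert (0 <= k * (- 1 - z L t) * e L t) by (repeat apply Rmult_le_pos; lra). lra.
    (* The condition [W_xx W <= W_x^2] at [x = 0] reduces to [1 + tau <= exp tau]. *)
    - intros t Ht. specialize (Htau t Ht).
      set (tau := k * k * (t - t0)) in *.
      assert (Ez : z 0 t = 2 * tau) by (unfold z, tau; ring).
      assert (Ee : e 0 t = exp tau) by (unfold e, tau; f_equal; ring).
      rewrite Ez, Ee.
      assert (He : 0 < exp tau) by apply exp_pos.
      assert (A := exp_ge_1p tau).
      split.
      + assert (0 < k * (1 + 2 * tau) * exp tau)
          by (repeat apply Rmult_lt_0_compat; lra). lra.
      + assert (0 <= k * k * exp tau * (exp tau - (1 + tau)))
          by (repeat apply Rmult_le_pos; lra). nra.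
    - intros x t Hx Ht _. ring_simplify. lra. }
  apply Rle_lt_trans with (2 := Hmain).
  (* Here [z >= 1 / 2] and [e >= 1] give [1 <= 2 z e], hence [4 k (1 + z) e / (1 + 2 z e) >= k]. *)
  assert (Hz : 1 / 2 <= z x1 t1) by (unfold z; lra).
  assert (He : 1 <= e x1 t1).
  { unfold e. rewrite <- exp_0 at 1. apply exp_nondecreasing; lra. }
  apply Rle_div_r; [apply HWpos; lra |].
  assert (1 / 2 * 1 <= z x1 t1 * e x1 t1) by (apply Rmult_le_compat; lra).
  nra.
Qed.

(** * Blow-up above a persistent plateau *)

Lemma is_derive_exp_ln (Z : R -> R) (q x dz : R) :
  0 < Z x -> is_derive Z x dz ->
  is_derive (fun y => exp (- q * ln (Z y))) x (- q * dz / Z x * exp (- q * ln (Z x))).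
Proof.
  intros HZ Hd. auto_derive.
  - split; [exists dz; exact Hd | split; [exact HZ | exact I]].
  - rewrite (is_derive_unique (fun y : R => Z y) x dz Hd). unfold Rdiv. ring.
Qed.

(* [w = (z0 - (t - T) / (2 q) + x^2 / (8 q)) ^ (- q)] with [q = 1 / (p - 1)] is a
   subsolution that blows up at [x = 0]. *)
Lemma no_persistent_plateau (p : R) (phi : R -> R) (u ut ux uxx : R -> R -> R) (c : R) :
  1 < p -> global_solution p phi u ut ux uxx -> positive_in_Omega u -> 0 < c ->
  ~ (forall L, exists T, 0 < T /\ forall x t, T <= t -> 0 <= x <= L -> c < u x t).
Proof.
  intros Hp Hu Hpos Hc Hplateau.
  set (q := 1 / (p - 1)).
  assert (Hq : 0 < q) by (apply Rdiv_lt_0_compat; lra).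
  assert (Hqp : q * (p - 1) = 1) by (unfold q; field; lra).
  (* Chosen so that [z0 ^ (- q) = c / 2]. With [L^2 / (8 q) >= z0] below, [w] stays under [c] on the
     initial slice and at [x = L] until the blow-up time [T + 2 q z0]. *)
  set (z0 := exp (- ln (c / 2) / q)).
  assert (Hz0 : 0 < z0) by apply exp_pos.
  set (L := 1 + 8 * q * z0).
  assert (HL : z0 <= L * L / (8 * q)).
  { apply Rle_div_r; unfold L; nra. }
  assert (HL0 : 0 < L) by (unfold L; nra).
  destruct (Hplateau L) as [T [HT Hc']].
  set (Z := fun x t => z0 - (t - T) / (2 * q) + x * x / (8 * q)).
  set (w := fun x t => exp (- q * ln (Z x t))).
  assert (HZ : forall x t, t < T + 2 * q * z0 -> x * x / (8 * q) < Z x t).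
  { intros x t Ht. unfold Z.
    assert ((t - T) / (2 * q) < z0); [apply Rlt_div_l; nra | lra]. }
  assert (HZ0 : forall x t, t < T + 2 * q * z0 -> 0 < Z x t).
  { intros x t Ht. apply Rle_lt_trans with (2 := HZ x t Ht).
    apply Rle_div_r; nra. }
  assert (Hsmall : forall x t, z0 <= Z x t -> w x t < c).
  { intros x t HZxt. apply Rle_lt_trans with (c / 2); [| lra].
    rewrite <- (exp_ln (c / 2)) by lra.
    assert (ln z0 <= ln (Z x t)).
    { destruct (Rle_lt_or_eq_dec _ _ HZxt) as [H | <-]; [| lra].
      apply Rlt_le, ln_increasing; assumption. }
    assert (Eln : q * ln z0 = - ln (c / 2)).
    { unfold z0. rewrite ln_exp. field; lra. }
    assert (- q * ln (Z x t) <= ln (c / 2)) by nra.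
    apply exp_nondecreasing; assumption. }
  assert (DxZ : forall x t, is_derive (fun y => Z y t) x (x / (4 * q))).
  { intros x t. unfold Z. auto_derive; [exact I |].
    real_equation. field. lra. }
  assert (DtZ : forall x t, is_derive (fun s => Z x s) t (- / (2 * q))).
  { intros x t. unfold Z. auto_derive; [exact I |].
    real_equation. field. lra. }
  assert (Hcmp : forall t, T <= t < T + 2 * q * z0 -> w 0 t < u 0 t).
  { intros t1 Ht1.
    refine (comparison p phi u ut ux uxx w
      (fun x t => / (2 * Z x t) * w x t)
      (fun x t => - x / (4 * Z x t) * w x t)
      (fun x t => (- / (4 * Z x t) + (q + 1) * (x * x) / (q * 16 * (Z x t * Z x t))) * w x t)
      L T t1 Hu Hpos HL0 HT _ _ _ _ _ _ _ _ 0 t1 _ _); try lra.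
    - intros x t Hx Ht. apply (continuity_2d_pt_continuous w).
      apply (continuity_2d_pt_comp _ Z (fun s => exp (- q * ln s))).
      + reflexivity.
      + auto_derive. apply HZ0; lra.
      + unfold Z, Rdiv. continuity_2d.
    - intros x Hx. apply Rlt_trans with c; [| apply Hc'; lra].
      apply Hsmall. unfold Z.
      assert (0 <= x * x / (8 * q)) by (apply Rle_div_r; nra). lra.
    - intros t Ht. apply Rlt_trans with c; [| apply Hc'; lra].
      apply Hsmall. assert (A := HZ L t ltac:(lra)). lra.
    - intros t Ht. split; [apply exp_pos | lra].
    - intros x t Hx Ht. assert (A := HZ0 x t ltac:(lra)).
      evar_last; [apply (is_derive_exp_ln (fun y => Z y t)); [exact A | apply DxZ] |].
      unfold w. simpl. field. lra.
    - intros x t Hx Ht. assert (A := HZ0 x t ltac:(lra)).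
      evar_last.
      { apply (is_derive_mult (fun y => - y / (4 * Z y t)) (fun y => w y t)).
        - apply (is_derive_div (fun y => - y) (fun y => 4 * Z y t) x (- 1) (4 * (x / (4 * q)))).
          + by_auto_derive.
          + apply (is_derive_scal (fun y => Z y t)). apply DxZ.
          + lra.
        - apply (is_derive_exp_ln (fun y => Z y t)); [exact A | apply DxZ].
        - intros; apply Rmult_comm. }
      unfold w, plus, mult. simpl. field. lra.
    - intros x t Hx Ht. assert (A := HZ0 x t ltac:(lra)).
      evar_last; [apply (is_derive_exp_ln (fun s => Z x s)); [exact A | apply DtZ] |].
      unfold w. simpl. field. lra.
    (* Since [q p = q + 1], the source is [w / Z]. It exceeds the sum of [w_t = w / (2 Z)] and the
       diffusive loss [w / (4 Z)]; the remaining part of [w_xx] and the convection term [- w w_x]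
       are nonnegative because [w] decreases in [x]. *)
    - intros x t Hx Ht _. assert (A := HZ0 x t ltac:(lra)).
      assert (Hw : 0 < w x t) by apply exp_pos.
      assert (Hwp : Rpower (w x t) p = / Z x t * w x t).
      { unfold Rpower, w. rewrite ln_exp.
        rewrite <- (exp_ln (Z x t)) at 2 by exact A.
        rewrite <- exp_Ropp, <- exp_plus. f_equal.
        replace (p * (- q * ln (Z x t))) with (- (q * (p - 1) + q) * ln (Z x t)) by ring.
        rewrite Hqp. ring. }
      rewrite Hwp.
      assert (Hi : 0 < / Z x t) by (apply Rinv_0_lt_compat; exact A).
      assert (0 <= (q + 1) * (x * x) / (q * 16 * (Z x t * Z x t)) * w x t).
      { assert (0 < q * (Z x t * Z x t)) 
          by (apply Rmult_lt_0_compat; [lra | apply Rmult_lt_0_compat; lra]).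
        apply Rmult_le_pos; [apply Rmult_le_pos; [apply Rmult_le_pos; nra |] | lra].
        apply Rlt_le, Rinv_0_lt_compat; lra. }
      replace (/ (2 * Z x t)) with (/ 2 * / Z x t) by (field; lra).
      replace (/ (4 * Z x t)) with (/ 4 * / Z x t) by (field; lra).
      replace (- x / (4 * Z x t)) with (- (x * / 4 * / Z x t)) by (field; lra).
      assert (0 <= x * / 4 * / Z x t * w x t * w x t)
        by (repeat apply Rmult_le_pos; lra).
      assert (0 < / Z x t * w x t) by (apply Rmult_lt_0_compat; lra). nra. }
  destruct Hu as [_ [_ _ _ Ucont _ _ _] _ _ _].
  set (t' := T + 2 * q * z0).
  assert (Ht' : T < t') by (unfold t'; nra).
  destruct (jointly_continuous_on_eps _ _ _ 0 t' 1 Ucont) as [d [Hd H]];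
    [unfold Omega_bar; lra | lra | lra |].
  set (m := Rabs (u 0 t') + 1).
  assert (Hm : 0 < m) by (assert (A := Rabs_pos (u 0 t')); unfold m; lra).
  (* Continuity bounds [u 0] by [m] near [t']. At time [t' - r / 2] one has
     [Z 0 = r / (4 q) < m ^ (- 1 / q)], so [w 0] is already at least [m]. *)
  set (r := Rmin (Rmin d (t' - T)) (2 * q * exp (- ln m / q))).
  assert (Hr : 0 < r).
  { unfold r. assert (0 < exp (- ln m / q)) by apply exp_pos.
    repeat apply Rmin_glb_lt; nra. }
  assert (Hr1 : r <= Rmin d (t' - T)) by apply Rmin_l.
  assert (Hr2 : r <= 2 * q * exp (- ln m / q)) by apply Rmin_r.
  assert (Rmin d (t' - T) <= d) by apply Rmin_l.
  assert (Rmin d (t' - T) <= t' - T) by apply Rmin_r.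
  set (t := t' - r / 2).
  assert (A := Rabs_def2 _ _ (H 0 t ltac:(unfold Omega_bar; lra) ltac:(unfold t; lra)
    ltac:(rewrite Rminus_diag, Rabs_R0; lra) ltac:(apply Rabs_def1; unfold t; lra))).
  assert (B := Hcmp t ltac:(unfold t, t' in *; lra)).
  assert (C : m <= w 0 t).
  { rewrite <- (exp_ln m) by exact Hm. unfold w.
    assert (E : Z 0 t = r / 2 / (2 * q)) by (unfold Z, t, t'; field; lra).
    assert (HZt : 0 < Z 0 t) by (rewrite E; repeat apply Rdiv_lt_0_compat; lra).
    assert (Z 0 t < exp (- ln m / q)) by (rewrite E; apply Rlt_div_l; lra).
    assert (D : ln (Z 0 t) < - ln m / q).
    { rewrite <- (ln_exp (- ln m / q)). apply ln_increasing; assumption. }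
    apply Rlt_div_r in D; [| exact Hq].
    apply Rlt_le, exp_increasing. lra. }
  assert (D := Rle_abs (u 0 t')). unfold m in C. lra.
Qed.

(** * Self-similar growth of a small bump *)

Lemma nonincreasing_of_derive (f f' : R -> R) (a b : R) :
  a <= b -> (forall c, a <= c <= b -> is_derive f c (f' c)) ->
  (forall c, a <= c <= b -> f' c <= 0) -> f b <= f a.
Proof.
  intros Hab Hd Hn.
  destruct (MVT_gen f a b f') as [c [Hc E]].
  - intros c Hc. rewrite Rmin_left, Rmax_right in Hc by lra. apply Hd; lra.
  - intros c Hc. rewrite Rmin_left, Rmax_right in Hc by lra.
    apply derivable_continuous_pt. exists (f' c). apply is_derive_Reals, Hd, Hc.
  - rewrite Rmin_left, Rmax_right in Hc by lra. specialize (Hn c Hc). nra.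
Qed.

Lemma is_derive_RInt_0 (f : R -> R) (x : R) :
  (forall y, ex_derive f y) -> is_derive (fun y => RInt f 0 y) x (f x).
Proof.
  intros Hf. apply (is_derive_RInt f (fun y => RInt f 0 y) 0).
  - apply filter_forall. intros y. apply (RInt_correct f).
    apply (ex_RInt_continuous f). intros z _.
    apply (ex_derive_continuous f), Hf.
  - apply (ex_derive_continuous f), Hf.
Qed.

(* In the variable [xi = x / sqrt s] the potential [1 + A Rf xi] is a perturbation of
   [1 + A sqrt PI erfc (xi / 2)], whose total mass is constant. The [a]-term makes [h]
   vanish at [X] and leaves room for the amplitude [A] to grow like [s ^ G] as long as
   [2 a <= A <= M - 1]; the last clause makes the terminal profile dominate the initial
   profile of [plateau_spreads]. *)
Lemma self_similar_profile (mu : R) :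
  0 < mu ->
  exists (M a X G : R) (h Rf : R -> R),
    0 < a /\ 0 < X /\ 0 < G /\ 2 * a <= M - 1 /\ 4 * a * X < mu /\
    (forall x, is_derive Rf x (- h x)) /\
    (forall x, is_derive h x (- x / 2 * h x - a * exp (- M * x))) /\
    h 0 = 1 /\ a * Rf 0 <= 1 / 2 /\
    (forall x, 0 <= x -> 0 <= Rf x /\ h x <= 1 /\ G * h x <= a * exp (- M * x)) /\
    (forall x, X <= x -> h x <= 0) /\
    (forall x, 0 <= x <= 32 ->
       1 / 8 * (1 + (M - 1) * Rf x) <= 2 * (M - 1) * h x).
Proof.
  intros Hmu.
  assert (HM : exists M, 2 <= M /\ forall x, 0 <= x <= 32 ->
      1 <= (M - 1) * exp (- (x * x) / 4)).
  (* On [[0, 32]] the exponent [x^2 / 4] is at most [32^2 / 4 = 256]. *)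
  { exists (exp 256 + 1). assert (B := exp_ge_1p 256). split; [lra |].
    intros x Hx. replace (exp 256 + 1 - 1) with (exp 256) by ring.
    rewrite <- exp_plus. assert (C := exp_ge_1p (256 + - (x * x) / 4)).
    assert (x * x <= 32 * 32) by nra. lra. }
  destruct HM as [M [HM HM1]].
  (* Variation of constants: with [g = exp (- x^2 / 4)] and [g * om = exp (- M x)], the function
     [g (1 - a Om)] solves the required equation for [h]. *)
  set (om := fun y => exp (y * y / 4 - M * y)).
  set (Om := (fun x => RInt om 0 x) : R -> R).
  assert (Dom : forall x, ex_derive om x) by (intros x; unfold om; auto_derive; exact I).
  assert (DOm : forall x, is_derive Om x (om x)) by (intros; apply is_derive_RInt_0, Dom).
  assert (om_pos : forall x, 0 < om x) by (intros; apply exp_pos).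
  assert (Om0 : Om 0 = 0) by exact (RInt_point 0 om).
  assert (Om_incr : forall x y, x <= y -> Om x <= Om y).
  { intros x y Hxy.
    assert (B := nonincreasing_of_derive (fun x => - Om x) (fun x => - om x) x y Hxy).
    apply Ropp_le_cancel, B.
    - intros c _. apply (is_derive_opp Om), DOm.
    - intros c _. specialize (om_pos c). lra. }
  set (E0 := exp (- M * M)).
  assert (HE0 : 0 < E0) by apply exp_pos.
  (* Completing the square, [y^2 / 4 - M y = (y / 2 - M)^2 - M^2], shows that [Om] grows at least
     quadratically, so [X / Om X] can be made small. *)
  assert (Om_large : forall x, 0 <= x -> E0 * (x * x / 2 - 2 * M * x) <= Om x).
  { intros x Hx.
    assert (B := nonincreasing_of_derive
      (fun x => E0 * (x * x / 2 - 2 * M * x) - Om x)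
      (fun x => E0 * (x - 2 * M) - om x) 0 x Hx).
    cbv beta in B. rewrite Om0 in B.
    enough (E0 * (x * x / 2 - 2 * M * x) - Om x <= E0 * (0 * 0 / 2 - 2 * M * 0) - 0) by lra.
    apply B.
    - intros c _. apply (is_derive_minus (fun x => E0 * (x * x / 2 - 2 * M * x)) Om);
        [| apply DOm].
      auto_derive; [exact I |].
      real_equation. field.
    - intros c _.
      assert (Eom : om c = E0 * exp ((c / 2 - M) * (c / 2 - M))).
      { unfold om, E0. rewrite <- exp_plus. f_equal. field. }
      rewrite Eom. assert (C := exp_ge_1p ((c / 2 - M) * (c / 2 - M))).
      assert (c - 2 * M <= exp ((c / 2 - M) * (c / 2 - M))); [| nra].
      assert (0 <= (c / 2 - M - 1) * (c / 2 - M - 1)) by apply Rle_0_sqr. lra. }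
  assert (HOm32 : 0 <= Om 32) by (rewrite <- Om0; apply Om_incr; lra).
  (* [X] will satisfy [Om X >= K X] and [a = 1 / Om X]. The three terms of [K] then serve, in turn,
     [4 a X < mu], [a <= 1 / 8] and [a Om 32 <= 1 / 2]. *)
  set (K := 4 / mu + 9 + 2 * Om 32).
  assert (Hmu' : 0 < 4 / mu) by (apply Rdiv_lt_0_compat; lra).
  set (X := 4 * M + 2 * (K / E0)).
  assert (HKE : 0 < K / E0) by (apply Rdiv_lt_0_compat; [unfold K; lra | lra]).
  assert (HX : 1 <= X) by (unfold X; lra).
  assert (HOmX : K * X <= Om X).
  { apply Rle_trans with (2 := Om_large X ltac:(lra)). right. unfold X. field. lra. }
  assert (HKX : K <= K * X) by (unfold K in *; nra).
  assert (HX32 : 32 <= X).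
  { apply Rnot_lt_le. intros H. assert (B := Om_incr X 32 ltac:(lra)).
    unfold K in *; lra. }
  (* This makes [1 - a Om], hence [h], change sign exactly at [X]. *)
  set (a := 1 / Om X).
  assert (HOmX0 : 9 < Om X) by (unfold K in *; lra).
  assert (Ha : 0 < a) by (apply Rdiv_lt_0_compat; lra).
  assert (HaOm : a * Om X = 1) by (unfold a; field; lra).
  assert (Ha8 : a <= 1 / 8) by nra.
  set (g := fun x => exp (- (x * x) / 4)).
  set (h := fun x => g x * (1 - a * Om x)).
  assert (g_pos : forall x, 0 < g x) by (intros; apply exp_pos).
  assert (g_le : forall x, g x <= 1).
  { intros x. unfold g. rewrite <- exp_0. apply exp_nondecreasing. nra. }
  assert (Dg : forall x, is_derive g x (- x / 2 * g x)).
  { intros x. unfold g. auto_derive; [exact I |].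
    real_equation. unfold Rdiv. field. }
  assert (g_om : forall x, g x * om x = exp (- M * x)).
  { intros x. unfold g, om. rewrite <- exp_plus. f_equal. field. }
  assert (Dh : forall x, is_derive h x (- x / 2 * h x - a * exp (- M * x))).
  { intros x. evar_last.
    - apply (is_derive_mult g (fun x => 1 - a * Om x)).
      + apply Dg.
      + apply (is_derive_minus (fun _ => 1) (fun x => a * Om x)).
        * apply (is_derive_const 1).
        * apply (is_derive_scal Om), DOm.
      + intros; apply Rmult_comm.
    - rewrite <- g_om. unfold h, plus, mult, minus, plus, opp, zero. simpl. ring. }
  assert (h_le : forall x, 0 <= x -> h x <= g x).
  { intros x Hx. unfold h. assert (B := Om_incr 0 x Hx). rewrite Om0 in B.
    specialize (g_pos x). assert (0 <= a * Om x) by nra. nra. }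
  assert (h_nonneg : forall x, x <= X -> 0 <= h x).
  { intros x Hx. unfold h. assert (B := Om_incr x X Hx).
    specialize (g_pos x). assert (a * Om x <= a * Om X) by nra. nra. }
  assert (h_nonpos : forall x, X <= x -> h x <= 0).
  { intros x Hx. unfold h. assert (B := Om_incr X x Hx).
    specialize (g_pos x). assert (a * Om X <= a * Om x) by nra. nra. }
  (* The integral of [h] from [x] to [X]; the sign change of [h] at [X] keeps it nonnegative on both
     sides. *)
  set (Rf := (fun x => RInt h 0 X - RInt h 0 x) : R -> R).
  assert (DRf : forall x, is_derive Rf x (- h x)).
  { intros x. evar_last.
    - apply (is_derive_minus (fun _ => RInt h 0 X) (fun x => RInt h 0 x)).
      + apply (is_derive_const (RInt h 0 X)).
      + apply is_derive_RInt_0. intros y. eexists. apply Dh.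
    - unfold minus, plus, opp, zero. simpl. ring. }
  assert (RfX : Rf X = 0) by (unfold Rf; ring).
  assert (Rf_nonneg : forall x, 0 <= Rf x).
  { intros x. rewrite <- RfX. destruct (Rle_lt_dec x X) as [Hx | Hx].
    - apply (nonincreasing_of_derive Rf (fun x => - h x)); [exact Hx | intros; apply DRf |].
      intros c Hc. specialize (h_nonneg c ltac:(lra)). lra.
    - apply Ropp_le_cancel.
      apply (nonincreasing_of_derive (fun x => - Rf x) (fun x => - - h x)); [lra | |].
      + intros c _. apply (is_derive_opp Rf), DRf.
      + intros c Hc. specialize (h_nonpos c ltac:(lra)). lra. }
  (* A Gaussian tail bound: [4 / (1 + x) * g - Rf] is nonincreasing up to [X] and nonnegative there,
     because the factor of [g] in its derivative is at most [-1] and [h <= g]. *)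
  assert (Rf_le : forall x, 0 <= x <= X -> Rf x <= 4 * g x).
  { intros x Hx.
    assert (B := nonincreasing_of_derive (fun x => 4 / (1 + x) * g x - Rf x)
      (fun x => (- 4 / ((1 + x) * (1 + x)) + 4 / (1 + x) * (- x / 2)) * g x + h x) x X
      (proj2 Hx)).
    assert (C : 0 <= 4 / (1 + X)) by (apply Rle_div_r; lra).
    assert (D : 4 / (1 + x) <= 4) by (apply Rle_div_l; lra).
    assert (Rf x <= 4 / (1 + x) * g x).
    { assert (0 <= 4 / (1 + X) * g X) by (specialize (g_pos X); nra).
      enough (4 / (1 + X) * g X - Rf X <= 4 / (1 + x) * g x - Rf x) by lra.
      apply B.
      - intros c Hc. evar_last.
        + apply (is_derive_minus (fun x => 4 / (1 + x) * g x) Rf); [| apply DRf].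
          apply (is_derive_mult (fun x => 4 / (1 + x)) g).
          * apply (is_derive_div (fun _ => 4) (fun x => 1 + x) c 0 1).
            -- apply (is_derive_const 4).
            -- by_auto_derive.
            -- lra.
          * apply Dg.
          * intros; apply Rmult_comm.
        + unfold minus, plus, mult, opp. simpl. field. lra.
      - intros c Hc. assert (E := h_le c ltac:(lra)).
        assert (F : - 4 / ((1 + c) * (1 + c)) + 4 / (1 + c) * (- c / 2)
          = - (3 + c * c) / ((1 + c) * (1 + c)) - 1) by (field; lra).
        assert (0 <= (3 + c * c) / ((1 + c) * (1 + c))) by (apply Rle_div_r; nra).
        replace (- (3 + c * c) / ((1 + c) * (1 + c)))
          with (- ((3 + c * c) / ((1 + c) * (1 + c)))) in F by (field; lra).
        rewrite F. specialize (g_pos c). nra. }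
    specialize (g_pos x). nra. }
  (* [G = a E0] works since [(x / 2 - M)^2 >= 0] gives [E0 g <= exp (- M x)]. *)
  exists M, a, X, (a * E0), h, Rf.
  repeat match goal with |- _ /\ _ => split end; try assumption; try lra.
  - apply Rmult_lt_0_compat; assumption.
  - apply Rmult_lt_reg_r with (Om X); [lra |].
    replace (4 * a * X * Om X) with (4 * X * (a * Om X)) by ring. rewrite HaOm.
    apply Rlt_le_trans with (mu * (K * X)); [| nra].
    assert (mu * (4 / mu) = 4) by (field; lra). 
    assert (0 < mu * (9 + 2 * Om 32) * X) by (repeat apply Rmult_lt_0_compat; lra).
    unfold K. nra.
  - unfold h, g. rewrite Om0. replace (- (0 * 0) / 4) with 0 by field. rewrite exp_0. ring.
  - assert (B := Rf_le 0 ltac:(lra)). specialize (g_le 0). specialize (Rf_nonneg 0). nra.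
  - intros x Hx. split; [apply Rf_nonneg |].
    assert (B := h_le x Hx). specialize (g_le x). split; [lra |].
    assert (E0 * g x <= exp (- M * x)).
    { unfold E0, g. rewrite <- exp_plus. apply exp_nondecreasing.
      assert (0 <= (x / 2 - M) * (x / 2 - M)) by apply Rle_0_sqr. lra. }
    assert (E0 * h x <= E0 * g x) by nra. nra.
  (* With [1 <= (M - 1) g] and [Rf <= 4 g], the left side is at most [5 / 8 * (M - 1) g], while
     [h >= g / 2]. *)
  - intros x Hx. specialize (HM1 x Hx). fold (g x) in HM1.
    assert (B := Rf_le x ltac:(lra)).
    assert (C := Om_incr x 32 ltac:(lra)).
    assert (a * Om x <= 1 / 2) by (unfold K in *; nra).
    assert (g x * (1 / 2) <= h x) by (unfold h; specialize (g_pos x); nra).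
    nra.
Qed.

(** Explicitly, [sq t = sqrt (t - t0 + r0^2)] and [A = A0 (sq / r0) ^ (2 G)]; the time [t1] is when
    [sq] reaches [r0 (A1 / A0) ^ (1 / (2 G))]. *)
Lemma self_similar_scales (t0 r0 G A0 A1 : R) :
  0 < r0 -> 0 < G -> 0 < A0 -> A0 <= A1 ->
  exists (t1 : R) (sq A : R -> R),
    t0 <= t1 /\ sq t0 = r0 /\ A t0 = A0 /\ A t1 = A1 /\
    forall t, t0 <= t <= t1 ->
      0 < sq t <= sq t1 /\ A0 <= A t <= A1 /\
      is_derive sq t (1 / (2 * sq t)) /\ is_derive A t (G * A t / (sq t * sq t)).
Proof.
  intros Hr0 HG HA0 HA1.
  set (r1 := r0 * exp (ln (A1 / A0) / (2 * G))).
  assert (HA : 1 <= A1 / A0) by (apply Rle_div_r; lra).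
  assert (Hln : 0 <= ln (A1 / A0)).
  { rewrite <- ln_1. destruct HA as [HA | <-]; [| lra].
    apply Rlt_le, ln_increasing; lra. }
  assert (Hr1 : r0 <= r1).
  { unfold r1. assert (B := exp_ge_1p (ln (A1 / A0) / (2 * G))).
    assert (0 <= ln (A1 / A0) / (2 * G)) by (apply Rle_div_r; lra). nra. }
  set (sq := fun t => sqrt (t - t0 + r0 * r0)).
  set (A := fun t => A0 * exp (2 * G * ln (sq t / r0))).
  set (t1 := t0 + r1 * r1 - r0 * r0).
  assert (Hsq1 : sq t1 = r1).
  { unfold sq, t1. replace (t0 + r1 * r1 - r0 * r0 - t0 + r0 * r0) with (r1 * r1) by ring.
    apply sqrt_square; lra. }
  assert (Hsq0 : sq t0 = r0).
  { unfold sq. rewrite Rminus_diag, Rplus_0_l. apply sqrt_square; lra. }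
  assert (HAt0 : A t0 = A0).
  { unfold A. rewrite Hsq0. unfold Rdiv. rewrite Rinv_r by lra.
    rewrite ln_1, Rmult_0_r, exp_0. ring. }
  assert (HAt1 : A t1 = A1).
  { unfold A. rewrite Hsq1. unfold r1.
    replace (r0 * exp (ln (A1 / A0) / (2 * G)) / r0) with (exp (ln (A1 / A0) / (2 * G)))
      by (field; lra).
    rewrite ln_exp.
    replace (2 * G * (ln (A1 / A0) / (2 * G))) with (ln (A1 / A0)) by (field; lra).
    rewrite exp_ln by lra. field; lra. }
  assert (Hmono : forall s t, t0 <= s <= t -> 0 < sq s <= sq t /\ A s <= A t).
  { intros s t Hst.
    assert (0 < sq s) by (apply sqrt_lt_R0; nra).
    assert (sq s <= sq t) by (apply sqrt_le_1; nra).
    repeat split; try assumption.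
    unfold A. apply Rmult_le_compat_l; [lra |]. apply exp_nondecreasing.
    apply Rmult_le_compat_l; [lra |].
    assert (0 < sq s / r0) by (apply Rdiv_lt_0_compat; lra).
    assert (sq s / r0 <= sq t / r0).
    { apply Rmult_le_compat_r; [apply Rlt_le, Rinv_0_lt_compat; lra | assumption]. }
    destruct H2 as [H2 | ->]; [| lra]. apply Rlt_le, ln_increasing; assumption. }
  assert (Dsq : forall t, t0 <= t -> is_derive sq t (1 / (2 * sq t))).
  { intros t Ht. unfold sq. auto_derive; [nra |].
    real_equation. unfold Rminus. reflexivity. }
  exists t1, sq, A.
  split; [unfold t1; nra |].
  split; [exact Hsq0 |]. split; [exact HAt0 |]. split; [exact HAt1 |].
  intros t Ht.
  split; [split | split; [split | split]].
  - apply (Hmono t t); lra.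
  - apply Hmono; lra.
  - rewrite <- HAt0. apply Hmono; lra.
  - rewrite <- HAt1. apply Hmono; lra.
  - apply Dsq; lra.
  - assert (Hpos : 0 < sq t) by (apply (Hmono t t); lra).
    unfold A. evar_last.
    + apply (is_derive_scal (fun t => exp (2 * G * ln (sq t / r0)))).
      apply (is_derive_comp exp (fun t => 2 * G * ln (sq t / r0))).
      * apply is_derive_exp.
      * apply (is_derive_scal (fun t => ln (sq t / r0))).
        apply (is_derive_comp ln (fun t => sq t / r0)).
        -- apply is_derive_ln. apply Rdiv_lt_0_compat; lra.
        -- apply (is_derive_div sq (fun _ => r0) t (1 / (2 * sq t)) 0);
             [apply Dsq; lra | apply (is_derive_const r0) | lra].
    + unfold scal; simpl. unfold mult; simpl. field. lra.
Qed.

(** The target, height [4 k] on width [1 / k], is invariant under the scaling of [x] by [sq]. Hence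
    it suffices to raise the amplitude [A] from [2 a] to [M - 1], however wide the profile becomes
    meanwhile. *)
Lemma bump_grows (p : R) (phi : R -> R) (u ut ux uxx : R -> R -> R) (t0 theta delta : R) :
  global_solution p phi u ut ux uxx -> positive_in_Omega u ->
  0 < t0 -> 0 < theta -> 0 < delta ->
  (forall x, 0 <= x <= delta -> theta < u x t0) ->
  exists t k, 0 < t /\ 0 < k /\ forall x, 0 <= x <= 1 / k -> 4 * k < u x t.
Proof.
  intros Hu Hpos Ht0 Hth Hde Hinit.
  destruct (self_similar_profile (theta * delta)) as
    (M & a & X & G & h & Rf & Ha & HX & HG & HaM & Hmu & DR & Dh & Hh0 & HR0 & Hprof
     & HhX & Hend).
  { apply Rmult_lt_0_compat; assumption. }
  (* With this width the initial profile is nonpositive beyond [delta], and its height is at most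
     [4 a / r0 = 4 a X / delta < theta]. *)
  set (r0 := delta / X).
  assert (Hr0 : 0 < r0) by (apply Rdiv_lt_0_compat; lra).
  destruct (self_similar_scales t0 r0 G (2 * a) (M - 1) Hr0 HG ltac:(lra) HaM) as
    (t1 & sq & A & Ht1 & Hsq0 & HA0 & HA1 & Hscale).
  assert (Hsq : forall t, t0 <= t <= t1 -> 0 < sq t) by (intros t Ht; apply Hscale, Ht).
  set (E := fun x => exp (- M * x)).
  set (h1 := fun x => - x / 2 * h x - a * E x).
  set (h2 := fun x => - h x / 2 - x / 2 * h1 x + a * M * E x).
  assert (DE : forall x, is_derive E x (- M * E x)).
  { intros x. unfold E. by_auto_derive. }
  assert (Dh1 : forall x, is_derive h1 x (h2 x)).
  { intros x. evar_last.
    - apply (is_derive_minus (fun x => - x / 2 * h x) (fun x => a * E x)).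
      + apply (is_derive_mult (fun x => - x / 2) h x (- 1 / 2)).
        * auto_derive; [exact I |].
          real_equation. field.
        * apply Dh.
        * intros; apply Rmult_comm.
      - apply (is_derive_scal E), DE.
    - fold (E x). unfold h2, h1, minus, plus, mult, opp. simpl. field. }
  assert (Rh : forall x, Derive (fun y : R => Rf y) x = - h x)
    by (intros; apply (is_derive_unique Rf), DR).
  assert (hh : forall x, Derive (fun y : R => h y) x = h1 x)
    by (intros; apply (is_derive_unique h), Dh).
  assert (h1h : forall x, Derive (fun y : R => h1 y) x = h2 x)
    by (intros; apply (is_derive_unique h1), Dh1).
  assert (ER : forall x, ex_derive (fun y : R => Rf y) x) by (intros; eexists; apply DR).
  assert (Eh : forall x, ex_derive (fun y : R => h y) x) by (intros; eexists; apply Dh).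
  assert (Eh1 : forall x, ex_derive (fun y : R => h1 y) x) by (intros; eexists; apply Dh1).
  assert (EA : forall t, t0 <= t <= t1 -> ex_derive (fun y : R => A y) t)
    by (intros t Ht; eexists; apply Hscale, Ht).
  assert (Esq : forall t, t0 <= t <= t1 -> ex_derive (fun y : R => sq y) t)
    by (intros t Ht; eexists; apply Hscale, Ht).
  assert (sq' : forall t, t0 <= t <= t1 -> Derive (fun y : R => sq y) t = 1 / (2 * sq t))
    by (intros; apply (is_derive_unique sq), Hscale; assumption).
  assert (A' : forall t, t0 <= t <= t1 ->
      Derive (fun y : R => A y) t = G * A t / (sq t * sq t))
    by (intros; apply (is_derive_unique A), Hscale; assumption).
  set (W := fun x t => 1 + A t * Rf (x / sq t)).
  set (P := fun x t => - A t * h (x / sq t) / sq t).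
  set (Q := fun x t => - A t * h1 (x / sq t) / (sq t * sq t)).
  set (T := fun x t => - A t * h2 (x / sq t) / (sq t * sq t * sq t)).
  set (Wt := fun x t => (G * A t * Rf (x / sq t) + A t * h (x / sq t) * (x / sq t) / 2)
    / (sq t * sq t)).
  set (Pt := fun x t => (- G * A t * h (x / sq t) + A t * h1 (x / sq t) * (x / sq t) / 2
    + A t * h (x / sq t) / 2) / (sq t * sq t * sq t)).
  assert (HA : forall t, t0 <= t <= t1 -> 2 * a <= A t <= M - 1)
    by (intros; apply Hscale; assumption).
  assert (HW : forall x t, 0 <= x -> t0 <= t <= t1 -> 1 <= W x t).
  { intros x t Hx Ht. unfold W. specialize (HA t Ht).
    assert (0 <= Rf (x / sq t)).
    { apply Hprof. apply Rle_div_r; [apply Hsq, Ht | lra]. }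
    nra. }
  assert (Csq : forall x t, t0 <= t <= t1 -> continuity_2d_pt (fun _ s => sq s) x t).
  { intros x t Ht. apply (continuity_2d_pt_comp _ (fun _ s => s) sq).
    - reflexivity.
    - apply Esq, Ht.
    - apply continuity_2d_pt_id2. }
  assert (Cxi : forall x t, t0 <= t <= t1 -> continuity_2d_pt (fun y s => y / sq s) x t).
  { intros x t Ht. unfold Rdiv. apply continuity_2d_pt_mult.
    - apply continuity_2d_pt_id1.
    - apply continuity_2d_pt_inv; [apply Csq, Ht | specialize (Hsq t Ht); lra]. }
  assert (CA : forall x t, t0 <= t <= t1 -> continuity_2d_pt (fun _ s => A s) x t).
  { intros x t Ht. apply (continuity_2d_pt_comp _ (fun _ s => s) A).
    - reflexivity.
    - apply EA, Ht.
    - apply continuity_2d_pt_id2. }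
  (* Since [sq] increases, [L / sq t >= X] up to [t1], so [h <= 0] at the right end. *)
  set (L := X * sq t1 + 1).
  assert (Hsq1 : 0 < sq t1) by (apply Hsq; lra).
  assert (HL : 0 < L) by (unfold L; nra).
  assert (Hcmp : forall x, 0 <= x <= L -> - 2 * P x t1 / W x t1 < u x t1).
  { intros x' Hx'.
    refine (hopf_cole_comparison p phi u ut ux uxx W P Q T Wt Pt L t0 t1
      Hu Hpos HL Ht0 _ _ _ _ _ _ _ _ _ _ _ _ x' t1 _ _); try lra.
    - intros x t Hx Ht. specialize (HW x t Hx Ht). lra.
    - intros x t _ Ht. apply (continuity_2d_pt_continuous W).
      apply continuity_2d_pt_plus; [apply continuity_2d_pt_const |].
      apply continuity_2d_pt_mult; [apply CA, Ht |].
      apply (continuity_2d_pt_comp _ (fun y s => y / sq s) Rf);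
        [reflexivity | apply ER | apply Cxi, Ht].
    - intros x t _ Ht. apply (continuity_2d_pt_continuous P).
      apply continuity_2d_pt_mult.
      + apply continuity_2d_pt_mult; [apply continuity_2d_pt_opp, CA, Ht |].
        apply (continuity_2d_pt_comp _ (fun y s => y / sq s) h);
          [reflexivity | apply Eh | apply Cxi, Ht].
      + apply continuity_2d_pt_inv; [apply Csq, Ht | specialize (Hsq t Ht); lra].
    - intros x t Ht. specialize (Hsq t Ht). unfold W, P. auto_derive; [auto |].
      rewrite Rh. unfold Rdiv. field. lra.
    - intros x t Ht. specialize (Hsq t Ht). unfold P, Q. auto_derive; [auto |].
      rewrite hh. unfold Rdiv. field. lra.
    - intros x t Ht. specialize (Hsq t Ht). unfold Q, T. auto_derive; [auto |].
      rewrite h1h. unfold Rdiv. field. lra.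
    - intros x t Ht. specialize (Hsq t Ht). unfold W, Wt.
      auto_derive; [repeat (split; auto); lra |].
      rewrite Rh, sq', A' by exact Ht. unfold Rdiv. field. lra.
    - intros x t Ht. specialize (Hsq t Ht). unfold P, Pt.
      auto_derive; [repeat (split; auto); lra |].
      rewrite hh, sq', A' by exact Ht. unfold Rdiv. field. lra.
    - intros x Hx. assert (HWx := HW x t0 ltac:(lra) ltac:(lra)).
      assert (EP : - 2 * P x t0 = 4 * a * h (x / r0) / r0)
        by (unfold P; rewrite HA0, Hsq0; field; lra).
      rewrite EP. destruct (Rle_lt_dec x delta) as [Hxd | Hxd].
      + apply Rle_lt_trans with (4 * a / r0).
        * apply Rle_div_l; [lra |].
          assert (0 < 4 * a / r0) by (apply Rdiv_lt_0_compat; lra).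
          assert (h (x / r0) <= 1) by (apply Hprof, Rle_div_r; lra).
          replace (4 * a * h (x / r0) / r0) with (4 * a / r0 * h (x / r0)) by (field; lra).
          nra.
        * apply Rlt_trans with theta; [| apply Hinit; lra].
          unfold r0. apply Rlt_div_l; [apply Rdiv_lt_0_compat; lra |].
          apply Rmult_lt_reg_r with X; [lra |].
          replace (theta * (delta / X) * X) with (theta * delta) by (field; lra). lra.
      + apply Rle_lt_trans with 0; [| apply Hpos; unfold Omega; lra].
        assert (h (x / r0) <= 0).
        { apply HhX. apply Rle_div_r; [lra |]. unfold r0.
          replace (X * (delta / X)) with delta by (field; lra). lra. }
        apply Rle_div_l; [lra |]. rewrite Rmult_0_l. apply Rle_div_l; nra.
    - intros t Ht. destruct (Hscale t Ht) as [[Hs Hs1] _]. specialize (HA t Ht).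
      assert (h (L / sq t) <= 0).
      { apply HhX. apply Rle_div_r; [lra |]. unfold L. nra. }
      unfold P. apply Rle_div_r; nra.
    - intros t Ht. specialize (Hsq t Ht). specialize (HA t Ht).
      assert (E0 : E 0 = 1) by (unfold E; rewrite Rmult_0_r; apply exp_0).
      assert (Ez : 0 / sq t = 0) by (field; lra).
      unfold P, Q, W. rewrite Ez, Hh0. unfold h1. rewrite E0. split.
      + apply Rlt_div_l; lra.
      (* The boundary condition amounts to [a (1 + A Rf 0) <= A], which follows from [A >= 2 a] and
         [a Rf 0 <= 1 / 2]. *)
      + assert (0 <= A t / (sq t * sq t) * (A t - a - A t * (a * Rf 0))).
        { apply Rmult_le_pos; [apply Rle_div_r; nra | nra]. }
        apply Rminus_le_0. eapply Rle_trans; [exact H |]. right. field. lra.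
    - intros x t Hx Ht HP. specialize (Hsq t Ht). specialize (HA t Ht).
      assert (Hh : 0 < h (x / sq t)).
      { apply Rnot_le_lt. intros Hn. assert (0 <= P x t); [| lra].
        unfold P. apply Rle_div_r; nra. }
      assert (Hxi : 0 <= x / sq t) by (apply Rle_div_r; lra).
      destruct (Hprof _ Hxi) as [HR [Hh1 HGh]]. fold (E (x / sq t)) in HGh.
      assert (HE : 0 < E (x / sq t)) by apply exp_pos.
      unfold W, P, Q, T, Wt, Pt. unfold h2, h1. revert Hh HR Hh1 HGh HE.
      set (xi := x / sq t). intros.
      (* The growth of [A] costs [G h <= a E]. What remains is [a E] times
         [(M - 1 - A) + A (1 - h) + M A Rf], a sum of nonnegative terms. *)
      assert (0 <= A t / (sq t * sq t * sq t) *
        (a * M * E xi * (1 + A t * Rf xi) - G * h xi - A t * a * h xi * E xi)).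
      { assert (0 < sq t * sq t * sq t) by (repeat apply Rmult_lt_0_compat; lra).
        apply Rmult_le_pos; [apply Rle_div_r; lra |].
        assert (0 < a * E xi) by (apply Rmult_lt_0_compat; lra).
        assert (0 <= a * E xi * (M - 1 - A t)) by (apply Rmult_le_pos; lra).
        assert (0 <= a * E xi * (A t * (1 - h xi)))
          by (repeat apply Rmult_le_pos; lra).
        assert (0 <= a * E xi * (M * (A t * Rf xi)))
          by (repeat apply Rmult_le_pos; lra).
        nra. }
      eapply Rle_trans; [exact H |]. right. field. lra. }
  assert (HX32 : 32 < X).
  { apply Rnot_le_lt. intros Hn. specialize (HhX 32 Hn).
    assert (B := Hend 32 ltac:(lra)). destruct (Hprof 32 ltac:(lra)) as [C _]. nra. }
  (* For this [k], [1 / k = 32 sq t1] and [4 k = 1 / (8 sq t1)]: these are the [32] and [1 / 8] of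
     the terminal profile. *)
  exists t1, (1 / (32 * sq t1)).
  split; [lra |]. split; [apply Rdiv_lt_0_compat; lra |].
  intros x Hx. replace (1 / (1 / (32 * sq t1))) with (32 * sq t1) in Hx by (field; lra).
  eapply Rle_lt_trans; [| apply Hcmp; unfold L; nra].
  assert (Hxi : 0 <= x / sq t1 <= 32) by (split; [apply Rle_div_r | apply Rle_div_l]; lra).
  assert (B := Hend _ Hxi). assert (HWx := HW x t1 ltac:(lra) ltac:(lra)).
  apply (proj1 (Rle_div_r _ _ (W x t1) ltac:(lra))). unfold W, P in *. rewrite HA1 in *.
  apply Rmult_le_reg_r with (sq t1); [lra |].
  replace (- 2 * (- (M - 1) * h (x / sq t1) / sq t1) * sq t1)
    with (2 * (M - 1) * h (x / sq t1)) by (field; lra).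
  eapply Rle_trans; [| exact B]. right. field. lra.
Qed.

(** * Assembling growth, spreading and blow-up *)

Theorem theorem3p11 (p : R) (hp : 3 < p) (phi : R -> R)
  (phi_cont : continuous_on Omega_bar phi)
  (phi_nonneg : forall x, Omega_bar x -> 0 <= phi x)
  (phi_0 : Rpower 2 ((1 - p) / (p - 3)) < phi 0) :
  ~ exists u ut ux uxx : R -> R -> R,
      global_solution p phi u ut ux uxx /\
      positive_in_Omega u /\
      growth_condition u ux.
Proof.
  intros (u & ut & ux & uxx & Hu & Hpos & _).
  assert (H0 : 0 < u 0 0).
  { rewrite (sol_init _ _ _ _ _ _ Hu) by (unfold Omega_bar; lra).
    apply Rlt_trans with (2 := phi_0). apply exp_pos. }
  destruct (jointly_continuous_on_eps _ _ _ 0 0 (u 0 0 / 2) (sol_cont _ _ _ _ _ _ Hu))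
    as [d [Hd Hnear]]; [unfold Omega_bar; lra | lra | lra |].
  (* Continuity at [(0, 0)] supplies a bump at the positive time [d / 2], where the differential
     equation is available. *)
  destruct (bump_grows p phi u ut ux uxx (d / 2) (u 0 0 / 2) (d / 2) Hu Hpos)
    as (t0 & k & Ht0 & Hk & Hbump); try lra.
  { intros x Hx.
    assert (B := Rabs_def2 _ _ (Hnear x (d / 2) ltac:(unfold Omega_bar; lra) ltac:(lra)
      ltac:(apply Rabs_def1; lra) ltac:(apply Rabs_def1; lra))). lra. }
  apply (no_persistent_plateau p phi u ut ux uxx k ltac:(lra) Hu Hpos Hk).
  (* After this delay [k^2 (t - t0) >= 1 + |k L|], which is at least [1 / 2] and at least [k x] on
     [[0, L]]. *)
  intros L. set (m := (1 + Rabs (k * L)) / (k * k)).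
  assert (Hm : k * k * m = 1 + Rabs (k * L)) by (unfold m; field; lra).
  assert (HL := Rle_abs (k * L)). assert (HL0 := Rabs_pos (k * L)).
  assert (Hm0 : 0 < m) by (apply Rdiv_lt_0_compat; nra).
  exists (t0 + m). split; [lra |].
  intros x t Ht Hx.
  assert (k * k * m <= k * k * (t - t0)) by (apply Rmult_le_compat_l; nra).
  apply (plateau_spreads p phi u ut ux uxx t0 k Hu Hpos Ht0 Hk Hbump); nra.
Qed.
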